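(* Let $p$ be prime, $G=\mathbb{Z}_{p^2}\times\mathbb{Z}_p$, and $A\subset G$ with $\#A>p^2$. Then for every $\mathbf{d}\in G\setminus\{0\}$ we have $(A-A)\cap\mathbf{d}G^*\neq\emptyset$.
   Context: $G^*$ denotes the set of invertible elements of the ring $G=\mathbb{Z}_{p^2}\times\mathbb{Z}_p$, i.e. pairs $(u_1,u_2)$ with $u_1\in\mathbb{Z}_{p^2}^*$, $u_2\in\mathbb{Z}_p^*$; for $\mathbf{d}=(d_1,d_2)$, $\mathbf{d}G^*=\{(d_1u_1,d_2u_2):(u_1,u_2)\in G^*\}$. $A-A=\{a-a':a,a'\in A\}$. *)

(* Defs.v *)
From HB Require Import structures.
From mathcomp Require Import all_boot all_order all_algebra.
Set Implicit Arguments. Unset Strict Implicit. Unset Printing Implicit Defensive.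
Import GRing.Theory.
Local Open Scope ring_scope.

Definition Gty (p : nat) : finType := ('Z_(p ^ 2) * 'Z_p)%type.

Definition Gunit (p : nat) (u : Gty p) : bool :=
  (u.1 \is a GRing.unit) && (u.2 \is a GRing.unit).

Definition dGstar (p : nat) (d : Gty p) : {set Gty p} :=
  [set x : Gty p | [exists u : Gty p, Gunit u && (x == (d.1 * u.1, d.2 * u.2))]].

Definition diffset (p : nat) (A : {set Gty p}) : {set Gty p} :=
  [set x : Gty p | [exists a : Gty p, exists a' : Gty p,
     [&& a \in A, a' \in A & x == (a.1 - a'.1, a.2 - a'.2)]]].

(* Main.v *)
Require Import Defs.
From mathcomp Require Import all_boot all_order all_algebra.
Set Implicit Arguments. Unset Strict Implicit. Unset Printing Implicit Defensive.
Import GRing.Theory.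
Local Open Scope ring_scope.

(* The orbit d G^* is described by two invariants of d: the p-adic valuation
   vp d.1 in {0, 1, 2} of the first coordinate (with vp 0 = 2) and whether
   d.2 vanishes; elements with equal invariants are associated (vp_factor,
   associated_Zp).  For a difference a - b, these invariants are read off the
   base-p digits (hi, lo) of the first coordinates: vp (a.1 - b.1) is 2 if
   a.1 = b.1, 1 if only the last digits agree, and 0 otherwise (vp_sub).
   Hence it suffices to show that a set avoiding one of the five kinds of
   nonzero differences has at most p^2 elements.  In each case a pair among
   the coordinates (hi a.1, lo a.1, a.2) is injective on A, possibly after
   observing that one coordinate is constant on A or on a fibre of lo a.1
   (constant_or_constant); the counting itself is card_le_pairs and
   card_le_fibres. *)

(* Two elements of a commutative ring are associated when they differ by a
   unit factor; d G^* is the set of x whose coordinates are associated to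
   those of d. *)
Definition associated {R : comUnitRingType} (x y : R) : Prop :=
  exists2 u : R, u \is a GRing.unit & y = x * u.

Lemma associated_mulr (R : comUnitRingType) (c k m : R) :
  k \is a GRing.unit -> m \is a GRing.unit -> associated (c * k) (c * m).
Proof.
move=> kU mU; exists (k^-1 * m); first by rewrite unitrM unitrV kU.
by rewrite mulrA -(mulrA c) mulrV // mulr1.
Qed.

Lemma card_le_fibres (T K : finType) (A : {set T}) (f : T -> K) (n : nat) :
  (forall k, #|[set a in A | f a == k]| <= n)%N -> (#|A| <= #|K| * n)%N.
Proof.
move=> small_fibres; rewrite -sum1_card (partition_big f xpredT) //= -sum_nat_const.
apply: leq_sum => k _; rewrite sum1dep_card.
by apply: leq_trans (small_fibres k); apply: eq_leq; apply: eq_card => a; rewrite !inE.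
Qed.

Lemma card_le_pairs (T K K' : finType) (A : {set T}) (f : T -> K) (g : T -> K') :
  {in A &, forall a b, f a = f b -> g a = g b -> a = b} ->
  (#|A| <= #|K| * #|K'|)%N.
Proof.
move=> inj; apply: (card_le_fibres (f := f)) => k; apply: (@leq_card_in _ _ g).
by move=> a b; rewrite !inE => /andP[aA /eqP fa] /andP[bA /eqP fb]; apply: inj; rewrite ?fa ?fb.
Qed.

(* If any two points of S agree under f or under g, then f or g is constant
   on S: two points separated by f force g to be constant. *)
Lemma constant_or_constant (T : finType) (U V : eqType) (S : {pred T})
    (f : T -> U) (g : T -> V) :
  {in S &, forall a b, f a = f b \/ g a = g b} ->
  {in S &, forall a b, f a = f b} \/ {in S &, forall a b, g a = g b}.
Proof.
move=> agree; have [f_const | ] := boolP [forall a in S, forall b in S, f a == f b].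
  by left=> a b aS bS; move/forall_inP/(_ a aS)/forall_inP/(_ b bS)/eqP: f_const.
rewrite negb_forall_in => /exists_inP[b bS]; rewrite negb_forall_in.
case/exists_inP=> c cS /eqP fbc; right.
have g_eq_b x : x \in S -> g x = g b.
  move=> xS; have [fxb | fxb] := eqVneq (f x) (f b).
    have [fxc | ->] := agree x c xS cS; first by case: fbc; rewrite -fxb.
    by have [/fbc | ->] := agree b c bS cS.
  by have [/eqP | ->] := agree x b xS bS; first by rewrite (negbTE fxb).
by move=> a a' aS a'S; rewrite !g_eq_b.
Qed.

Lemma diff_in_dGstar (p : nat) (A : {set Gty p}) (d a b : Gty p) :
  a \in A -> b \in A -> associated d.1 (a.1 - b.1) -> associated d.2 (a.2 - b.2) ->
  (a.1 - b.1, a.2 - b.2) \in diffset A :&: dGstar d.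
Proof.
move=> aA bA [u1 u1U e1] [u2 u2U e2]; rewrite !inE; apply/andP; split.
  by apply/existsP; exists a; apply/existsP; exists b; rewrite aA bA eqxx.
by apply/existsP; exists (u1, u2); rewrite /Gunit u1U u2U -e1 -e2 eqxx.
Qed.

Lemma card_Zp_type (n : nat) : (1 < n)%N -> #|'Z_n| = n.
Proof. by move=> n_gt1; rewrite card_ord Zp_cast. Qed.

Lemma val_Zp_lt (n : nat) (x : 'Z_n) : (1 < n)%N -> (x < n)%N.
Proof. by move=> n_gt1; rewrite -[X in (_ < X)%N](Zp_cast n_gt1) ltn_ord. Qed.

Section PrimeSquare.
Variable p : nat.
Hypothesis hp : prime p.

Lemma sqr_gt1 : (1 < p ^ 2)%N.
Proof. by rewrite (ltn_exp2l 0) ?prime_gt1. Qed.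

Lemma hi_subproof (x : 'Z_(p ^ 2)) : (x %/ p < p)%N.
Proof. by rewrite ltn_divLR ?prime_gt0 // mulnn val_Zp_lt ?sqr_gt1. Qed.

Definition lo (x : 'Z_(p ^ 2)) : 'I_p := Ordinal (ltn_pmod x (prime_gt0 hp)).
Definition hi (x : 'Z_(p ^ 2)) : 'I_p := Ordinal (hi_subproof x).

Lemma digits_inj (x y : 'Z_(p ^ 2)) : lo x = lo y -> hi x = hi y -> x = y.
Proof.
move=> /(congr1 val) /= elo /(congr1 val) /= ehi.
by apply: val_inj; rewrite /= (divn_eq x p) (divn_eq y p) elo ehi.
Qed.

Lemma dvdp_sub (x y : 'Z_(p ^ 2)) : (p %| (x - y)%R)%N = (lo x == lo y).
Proof.
have p_dvd : (p %| (Zp_trunc (p ^ 2)).+2)%N by rewrite Zp_cast ?dvdn_exp ?sqr_gt1.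
rewrite -[in RHS](subrK y x); move: (x - y) => z.
rewrite -val_eqE /= modn_dvdm //.
by rewrite -[X in _ == (X %% p)%N]add0n eqn_modDr mod0n.
Qed.

Lemma unit_Zp2 (x : 'Z_(p ^ 2)) : (x \is a GRing.unit) = ~~ (p %| x)%N.
Proof.
by rewrite -{1}[x]natr_Zp unitZpE ?sqr_gt1 // coprime_pexpl ?prime_coprime.
Qed.

(* The p-adic valuation on Z_{p^2}, with the convention v(0) = 2. *)
Definition vp (x : 'Z_(p ^ 2)) : nat :=
  if x == 0 then 2 else if x \is a GRing.unit then 0 else 1.

Lemma vp_sub (x y : 'Z_(p ^ 2)) :
  vp (x - y) = if x == y then 2%N else if lo x == lo y then 1%N else 0%N.
Proof. by rewrite /vp subr_eq0 unit_Zp2 dvdp_sub; case: (x == y); case: (lo x == lo y). Qed.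

Lemma vp_sub2 (x y : 'Z_(p ^ 2)) : (vp (x - y) == 2%N) = (x == y).
Proof. by rewrite vp_sub; case: (x == y); case: (lo x == lo y). Qed.

Lemma vp_sub1 (x y : 'Z_(p ^ 2)) : (vp (x - y) == 1%N) = (x != y) && (lo x == lo y).
Proof. by rewrite vp_sub; case: (x == y); case: (lo x == lo y). Qed.

Lemma vp_sub0 (x y : 'Z_(p ^ 2)) : (vp (x - y) == 0%N) = (lo x != lo y).
Proof.
rewrite vp_sub; have [-> | _] := eqVneq x y; first by rewrite eqxx.
by case: (lo x == lo y).
Qed.

Lemma vp_factor (x : 'Z_(p ^ 2)) :
  exists2 k, k \is a GRing.unit & x = p%:R ^+ vp x * k.
Proof.
rewrite /vp; have [-> | x0] := eqVneq x 0.
  by exists 1; rewrite ?unitr1 // mulr1 -natrX pchar_Zp ?sqr_gt1.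
case: ifP => [xU | xNU]; first by exists x; rewrite ?mul1r.
have px : (p %| x)%N by rewrite unit_Zp2 in xNU; apply: negbFE.
exists (x %/ p)%:R; last by rewrite expr1 -natrM mulnC divnK // natr_Zp.
rewrite unitZpE ?sqr_gt1 // coprime_pexpl // prime_coprime // gtnNdvd ?hi_subproof //.
rewrite divn_gt0 ?prime_gt0 // dvdn_leq // lt0n.
by apply: contra x0 => /eqP x_0; apply/eqP/val_inj.
Qed.

Lemma vp_associated (x y : 'Z_(p ^ 2)) : vp x = vp y -> associated x y.
Proof.
move=> vp_xy; have [k kU ->] := vp_factor x; have [m mU ->] := vp_factor y.
by rewrite vp_xy; apply: associated_mulr.
Qed.

Lemma unit_Zp_prime (x : 'Z_p) : (x \is a GRing.unit) = (x != 0).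
Proof.
rewrite -{1}[x]natr_Zp unitZpE ?prime_gt1 // prime_coprime //.
have [-> | x0] := eqVneq x 0; first by rewrite dvdn0.
rewrite gtnNdvd ?val_Zp_lt ?prime_gt1 // lt0n.
by apply: contra x0 => /eqP x_0; apply/eqP/val_inj.
Qed.

Lemma associated_Zp (x y : 'Z_p) : (x == 0) = (y == 0) -> associated x y.
Proof.
have [-> /esym/eqP -> | x0 /esym/negbT y0] := eqVneq x 0.
  by have := associated_mulr 0 (@unitr1 'Z_p) (@unitr1 'Z_p); rewrite mul0r.
have xU : x \is a GRing.unit by rewrite unit_Zp_prime.
have yU : y \is a GRing.unit by rewrite unit_Zp_prime.
by have := associated_mulr 1 xU yU; rewrite !mul1r.
Qed.

Definition diff_kind (a b : Gty p) : nat * bool := (vp (a.1 - b.1), a.2 == b.2).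

Variable A : {set Gty p}.

Definition avoids (k : nat * bool) : Prop := {in A &, forall a b, diff_kind a b != k}.

Lemma Gty_eq (a b : Gty p) : a.1 = b.1 -> a.2 = b.2 -> a = b.
Proof. by case: a b => [? ?] [? ?] /= -> ->. Qed.

Lemma card_Zp_prime : #|'Z_p| = p.
Proof. exact: card_Zp_type (prime_gt1 hp). Qed.

Lemma card_pp (K K' : finType) : #|K| = p -> #|K'| = p -> (#|K| * #|K'| = p ^ 2)%N.
Proof. by move=> -> ->; rewrite mulnn. Qed.

(* d = (0, nonzero): elements of A are determined by their first coordinate. *)
Lemma card_avoid_2F : avoids (2, false) -> (#|A| <= p ^ 2)%N.
Proof.
move=> avoid; rewrite -(card_Zp_type sqr_gt1).
apply: (@leq_card_in _ _ fst) => a b aA bA e1; apply: Gty_eq => //.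
by have := avoid a b aA bA; rewrite xpair_eqE vp_sub2 e1 eqxx eqbF_neg negbK => /eqP.
Qed.

(* d = (nonzero multiple of p, 0): elements of A are determined by the last
   digit of their first coordinate and their second coordinate. *)
Lemma card_avoid_1T : avoids (1, true) -> (#|A| <= p ^ 2)%N.
Proof.
move=> avoid; rewrite -(card_pp (card_ord p) card_Zp_prime).
apply: (card_le_pairs (f := fun a => lo a.1) (g := fun a : Gty p => a.2)) => a b aA bA elo e2.
apply: Gty_eq => //; apply/eqP.
by have := avoid a b aA bA; rewrite xpair_eqE vp_sub1 elo e2 !eqxx !andbT negbK.
Qed.

(* d = (unit, 0): elements of A are determined by the first digit of their
   first coordinate and their second coordinate. *)
Lemma card_avoid_0T : avoids (0, true) -> (#|A| <= p ^ 2)%N.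
Proof.
move=> avoid; rewrite -(card_pp (card_ord p) card_Zp_prime).
apply: (card_le_pairs (f := fun a => hi a.1) (g := fun a : Gty p => a.2)) => a b aA bA ehi e2.
apply: Gty_eq => //; apply: digits_inj ehi; apply/eqP.
by have := avoid a b aA bA; rewrite xpair_eqE vp_sub0 e2 !eqxx andbT negbK.
Qed.

(* d = (unit, nonzero): any two elements of A share the last digit of their
   first coordinate or their second coordinate, so one of these is constant
   on A and the two remaining digit coordinates determine the element. *)
Lemma card_avoid_0F : avoids (0, false) -> (#|A| <= p ^ 2)%N.
Proof.
move=> avoid.
have agree : {in A &, forall a b, lo a.1 = lo b.1 \/ a.2 = b.2}.
  move=> a b aA bA; have := avoid a b aA bA; rewrite xpair_eqE vp_sub0 eqbF_neg.
  by rewrite negb_and !negbK => /orP[/eqP | /eqP]; [left | right].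
have [lo_const | snd_const] := constant_or_constant agree.
  rewrite -(card_pp (card_ord p) card_Zp_prime).
  apply: (card_le_pairs (f := fun a => hi a.1) (g := fun a : Gty p => a.2)) => a b aA bA ehi e2.
  by apply: Gty_eq => //; apply: digits_inj ehi; apply: lo_const.
rewrite -(card_pp (card_ord p) (card_ord p)).
apply: (card_le_pairs (f := fun a => lo a.1) (g := fun a => hi a.1)) => a b aA bA elo ehi.
by apply: Gty_eq; [apply: digits_inj | apply: snd_const].
Qed.

(* d = (nonzero multiple of p, nonzero): inside a fibre of the last digit of
   the first coordinate, either the first or the second coordinate is
   constant, so each such fibre has at most p elements. *)
Lemma card_avoid_1F : avoids (1, false) -> (#|A| <= p ^ 2)%N.
Proof.
move=> avoid.
suff small_fibres k : (#|[set a in A | lo a.1 == k]| <= p)%N.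
  by apply: leq_trans (card_le_fibres small_fibres) _; rewrite card_ord mulnn.
set S := [set a in A | lo a.1 == k].
have agree : {in S &, forall a b, a.1 = b.1 \/ a.2 = b.2}.
  move=> a b; rewrite !inE => /andP[aA /eqP ka] /andP[bA /eqP kb].
  have := avoid a b aA bA; rewrite xpair_eqE vp_sub1 ka kb eqxx andbT eqbF_neg.
  by rewrite negb_and !negbK => /orP[/eqP | /eqP]; [left | right].
have [fst_const | snd_const] := constant_or_constant agree.
  have inj2 : {in S &, injective (fun a : Gty p => a.2)}.
    by move=> a b aS bS; apply: Gty_eq (fst_const a b aS bS).
  by apply: leq_trans (leq_card_in _ _ inj2) _; rewrite card_Zp_prime.
have inj_hi : {in S &, injective (fun a => hi a.1)}.
  move=> a b aS bS ehi; apply: Gty_eq (snd_const a b aS bS); apply: digits_inj ehi.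
  by move: aS bS; rewrite !inE => /andP[_ /eqP ->] /andP[_ /eqP ->].
by apply: leq_trans (leq_card_in _ _ inj_hi) _; rewrite card_ord.
Qed.

(* The kind of the difference d determines which of the five counting
   arguments applies; d = 0 is the only kind that cannot be avoided. *)
Lemma card_le_avoiding (d : Gty p) :
  d != (0, 0) -> avoids (vp d.1, d.2 == 0) -> (#|A| <= p ^ 2)%N.
Proof.
move=> d_nz; rewrite /vp; have [d1_0 | _] := eqVneq d.1 0.
  have d2_nz : d.2 != 0.
    by apply: contraNneq d_nz => d2_0; rewrite [d]surjective_pairing d1_0 d2_0.
  by rewrite (negbTE d2_nz); apply: card_avoid_2F.
case: (_ \is a _); case: (d.2 == 0).
- exact: card_avoid_0T.
- exact: card_avoid_0F.
- exact: card_avoid_1T.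
- exact: card_avoid_1F.
Qed.

End PrimeSquare.

Theorem lemma5p1 (p : nat) (hp : prime p) (A : {set Gty p})
  (hA : (p ^ 2 < #|A|)%N) (d : Gty p) (hd : d != (0, 0)) :
  diffset A :&: dGstar d != set0.
Proof.
apply/negP => /eqP no_diff.
suff : (#|A| <= p ^ 2)%N by rewrite leqNgt hA.
apply: (card_le_avoiding hp hd) => a b aA bA; apply/negP => /eqP[vp_eq zero_eq].
have assoc1 : associated d.1 (a.1 - b.1) := vp_associated hp (esym vp_eq).
have assoc2 : associated d.2 (a.2 - b.2) by apply: (associated_Zp hp); rewrite subr_eq0 zero_eq.
by have := diff_in_dGstar aA bA assoc1 assoc2; rewrite no_diff inE.
Qed.
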